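(* Let $n\ge 1$, $e\ge 0$ and $t>1$ be integers, $q=(2e+1)t$, and suppose $t^{n-1}\mid 2e+1$. Then the $q$-ary cyclic code $$\mathcal{C}_{n,e,q}=\left\langle\left(\frac{2e+1}{t^{n-1}},\frac{2e+1}{t^{n-2}},\ldots,\frac{2e+1}{t},2e+1\right)\right\rangle\subseteq\mathbb{Z}_q^n$$ (the subgroup generated by this single vector) belongs to $LPL^{\infty}(n,e,q)$.
   Context: For $a\in\mathbb{Z}_q$ with representative $\tilde a\in\{0,\dots,q-1\}$ put $|a|_1=\min\{\tilde a,q-\tilde a\}$. The maximum metric on $\mathbb{Z}_q^n$ is $d(x,y)=\max_i|x_i-y_i|_1$, and $B(x,r)=\{y\in\mathbb{Z}_q^n: d(x,y)\le r\}$. $LPL^{\infty}(n,e,q)$ is the set of linear perfect codes with packing radius $e$, i.e. of subgroups $C$ of $(\mathbb{Z}_q^n,+)$ with $\#C>1$ such that $\mathbb{Z}_q^n$ is the disjoint union of the balls $B(c,e)$, $c\in C$. A cyclic code is a subgroup of $\mathbb{Z}_q^n$ that is cyclic as an abelian group. *)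

(* Defs.v *)
From HB Require Import structures.
From mathcomp Require Import all_boot all_order all_algebra all_fingroup.

Set Implicit Arguments.
Unset Strict Implicit.
Unset Printing Implicit Defensive.

Import GRing.Theory.
Local Open Scope ring_scope.

(* The ring 'Z_q is Z/qZ only for q > 1; the definitions below
   are meaningful only for such q. The additive group Z_q^n is 'rV['Z_q]_n with
   its canonical finGroupType structure, whose (multiplicatively written) law
   is matrix addition. *)

Definition absZq (q : nat) (a : 'Z_q) : nat := minn a (q - a)%N.

Definition dist_max (q n : nat) (x y : 'rV['Z_q]_n) : nat :=
  \max_(i < n) absZq (x ord0 i - y ord0 i)%R.

Definition ball_max (q n : nat) (x : 'rV['Z_q]_n) (r : nat) :
    {set 'rV['Z_q]_n} :=
  [set y | (dist_max x y <= r)%N].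

(* Disjointness is required for the balls indexed by distinct codewords, and
   not merely for distinct balls (as it would be in terms of the set of balls,
   with finset's partition). *)
Definition LPL (n e q : nat) : {set {group 'rV['Z_q]_n}} :=
  [set C : {group 'rV['Z_q]_n} |
    [&& (1 < #|C|)%N,
        \bigcup_(c in C) ball_max c e == [set: 'rV['Z_q]_n]
      & [forall c in C, forall c' in C,
          (c != c') ==> [disjoint ball_max c e & ball_max c' e]]]].

(* The exponent n - 1 - i (with i counted from 0) runs through n-1, ..., 1, 0,
   so the last entry is 2e+1. *)
Definition code_gen (n e t q : nat) : 'rV['Z_q]_n :=
  \row_(i < n) ((2 * e + 1) %/ t ^ (n - 1 - i))%N%:R.

Definition cyclic_code (n e t q : nat) : {group 'rV['Z_q]_n} :=
  <[code_gen n e t q]>%G.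

(* Main.v *)
Require Import Defs.
From mathcomp Require Import all_boot all_order all_algebra all_fingroup.
From mathcomp Require Import zify ring.

Set Implicit Arguments.
Unset Strict Implicit.
Unset Printing Implicit Defensive.

Import GRing.Theory.
Local Open Scope ring_scope.

(** Write m = 2e+1, so that q = m t, and let g be the generator, with entries
    g_i = m / t ^ (n-1-i) for i < n.  Two facts carry the proof.

    In dimension one, the intervals of radius e centred at the multiples of m
    tile Z_q, because m is the length of such an interval and divides q:
    [absZq_cover] says that they cover, [absZq_tile] that they are disjoint.

    The generator is triangular with respect to the base-t expansion of the
    scalar k in k g: multiplication by t ^ j turns the entry g_(n-1-j) into m
    and annihilates every later entry, since m t = 0 in Z_q
    ([code_gen_pivot], [code_gen_annihilated]).  Hence the digit of k of weight
    t ^ j moves coordinate n-1-j by a multiple of m, without affecting the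
    coordinates after it.  Reading the coordinates from last to first, the
    one-dimensional tiling determines the digits of k one at a time: a suitable
    digit always exists, so the balls cover ([codeword_near]), and it is unique
    modulo t, so the balls around distinct codewords are disjoint
    ([codeword_eq0]). *)

(** * Absolute value on Z_q *)

Lemma natr_Zp_eq0 (q k : nat) : (1 < q)%N ->
  ((k%:R : 'Z_q) == 0) = (q %| k)%N.
Proof. by move=> q_gt1; rewrite -val_eqE /= val_Zp_nat. Qed.

Lemma val_Zp_addn (q k : nat) (a : 'Z_q) : (1 < q)%N ->
  val (a + k%:R) = ((a + k) %% q)%N.
Proof.
by move=> q_gt1; rewrite -[in LHS](natr_Zp a) -natrD /= val_Zp_nat.
Qed.

(** The interval [-e, e], which wraps around 0, becomes an initial segment of
    representatives after translation by e; the tiling of Z_q then reduces to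
    Euclidean division by 2e+1. *)
Lemma absZq_leE (q e : nat) (a : 'Z_q) : (1 < q)%N -> (e < q)%N ->
  (absZq a <= e)%N = (val (a + e%:R)%R <= 2 * e)%N.
Proof.
move=> q_gt1 lt_eq; rewrite val_Zp_addn // /absZq.
have : (a < q)%N by rewrite -[X in (_ < X)%N](Zp_cast q_gt1) ltn_ord.
move: (nat_of_ord a) => b lt_bq.
case: (ltnP (b + e) q) => [lt_q | le_q]; first by rewrite modn_small //; lia.
have -> : ((b + e) %% q = b + e - q)%N.
  by rewrite -{1}(subnK le_q) modnDr modn_small; lia.
lia.
Qed.

(** * The one-dimensional tiling *)

Section OneDimension.

Variables (e t q : nat).
Hypotheses (t_gt1 : (1 < t)%N) (q_def : q = ((2 * e + 1) * t)%N).

Let q_gt1 : (1 < q)%N. Proof. nia. Qed.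
Let lt_eq : (e < q)%N. Proof. nia. Qed.

(** After translation by e both points have representatives below 2e+1, and
    these are congruent modulo 2e+1 because 2e+1 divides q. *)
Lemma absZq_tile (a : 'Z_q) (s : nat) :
  (absZq a <= e)%N -> (absZq (a + (s * (2 * e + 1))%:R)%R <= e)%N ->
  ((s * (2 * e + 1))%:R : 'Z_q) = 0.
Proof.
rewrite !absZq_leE // addrAC; set u := (a + e%:R)%R => le_u.
set w := (u + _)%R => le_w.
have eq_wu : w = u.
  apply: val_inj.
  have : (val w = val u %[mod 2 * e + 1])%N.
    rewrite val_Zp_addn // modn_dvdm; last by rewrite q_def dvdn_mulr.
    by rewrite addnC modnMDl.
  by rewrite !modn_small //; lia.
by apply: (addrI u); rewrite addr0.
Qed.

(** The nearest multiple of 2e+1 is found by rounding, that is, by dividing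
    y + e instead of y. *)
Lemma absZq_cover (y : 'Z_q) :
  exists s : nat, (absZq ((s * (2 * e + 1))%:R - y)%R <= e)%N.
Proof.
set w : nat := (y + e)%N; exists (w %/ (2 * e + 1))%N.
rewrite absZq_leE //.
have lt_r : (w %% (2 * e + 1) < 2 * e + 1)%N by rewrite ltn_mod addn1.
have def_w := divn_eq w (2 * e + 1).
suff -> : (w %/ (2 * e + 1) * (2 * e + 1))%:R - y + e%:R =
          (2 * e - w %% (2 * e + 1))%:R :> 'Z_q.
  by rewrite /= val_Zp_nat // modn_small; nia.
have /(congr1 (fun k => k%:R : 'Z_q)) := def_w.
rewrite {1}/w natrD natr_Zp natrD => /(canRL (addrK _)) def_y.
rewrite natrB; last lia.
by rewrite def_y; ring.
Qed.

End OneDimension.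

(** * Digits of the scalar and coordinates of the codeword *)

Section Code.

Variables (n e t q : nat).
Hypothesis t_dvd : (t ^ (n - 1) %| 2 * e + 1)%N.

Local Notation g := (code_gen n e t q).

Lemma code_gen_pivot (i : 'I_n) (j : nat) : (i + j = n - 1)%N ->
  g ord0 i *+ t ^ j = (2 * e + 1)%:R.
Proof.
move=> eq_ij; have -> : j = (n - 1 - i)%N by lia.
rewrite mxE -mulrnA divnK //.
by apply: dvdn_trans t_dvd; apply: dvdn_exp2l; lia.
Qed.

Hypothesis t_gt1 : (1 < t)%N.
Hypothesis q_def : q = ((2 * e + 1) * t)%N.

Let q_gt1 : (1 < q)%N. Proof. nia. Qed.

Lemma code_gen_annihilated (i : 'I_n) (j : nat) : (n <= i + j)%N ->
  g ord0 i *+ t ^ j = 0.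
Proof.
move=> le_n; have lt_in := ltn_ord i.
have -> : j = (n - 1 - i + (1 + (i + j - n)))%N by lia.
rewrite expnD mulrnA code_gen_pivot; last lia.
apply/eqP; rewrite -mulrnA natr_Zp_eq0 // expnD expn1 mulnA q_def.
exact: dvdn_mulr.
Qed.

(** The scalar k is built digit by digit, the digit of weight t ^ j being
    chosen by rounding what is left of coordinate n-1-j of x. *)
Lemma codeword_near (x : 'rV['Z_q]_n) :
  exists k : nat, forall i : 'I_n, (absZq (g ord0 i *+ k - x ord0 i)%R <= e)%N.
Proof.
suff near_last (j : nat) : (j <= n)%N -> exists k : nat,
    forall i : 'I_n, (n <= i + j)%N ->
      (absZq (g ord0 i *+ k - x ord0 i)%R <= e)%N.
  have [k near_k] := near_last n (leqnn n).
  by exists k => i; apply: near_k; apply: leq_addl.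
elim: j => [_ | j IHj lt_jn].
  by exists 0%N => i; rewrite addn0 leqNgt ltn_ord.
have [k near_k] := IHj (ltnW lt_jn).
have lt_p : (n - 1 - j < n)%N by lia.
pose p := Ordinal lt_p.
have [s near_s] := absZq_cover t_gt1 q_def (x ord0 p - g ord0 p *+ k).
exists (k + t ^ j * s)%N => i le_n; rewrite mulrnDr mulrnA.
have [le_nj | lt_ijn] := leqP n (i + j).
  by rewrite code_gen_annihilated // mul0rn addr0 near_k.
have -> : i = p by apply: val_inj => /=; lia.
rewrite code_gen_pivot /=; last lia.
by rewrite -mulrnA mulnC -addrA addrCA -opprB.
Qed.

(** This is disjointness: z and z + k g are the differences c - y and c' - y
    for codewords c and c' = c + k g within distance e of a common point y.
    The n lowest base-t digits of k vanish, one coordinate at a time: once t ^ j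
    divides k, coordinate n-1-j of k g is a multiple of 2e+1, so [absZq_tile]
    makes it 0 in Z_q, which means that t ^ j.+1 divides k. *)
Lemma codeword_eq0 (z : 'rV['Z_q]_n) (k : nat) :
  (forall i : 'I_n, absZq (z ord0 i) <= e)%N ->
  (forall i : 'I_n, absZq (z ord0 i + g ord0 i *+ k)%R <= e)%N ->
  g *+ k = 0.
Proof.
move=> near_z near_zk.
suff dvd_k (j : nat) : (j <= n)%N -> (t ^ j %| k)%N.
  have /dvdnP[s ->] := dvd_k n (leqnn n).
  apply/rowP => i; rewrite mulmxnE mulnC mulrnA code_gen_annihilated ?leq_addl //.
  by rewrite mul0rn mxE.
elim: j => [_ | j IHj lt_jn]; first exact: dvd1n.
have /dvdnP[s def_k] := IHj (ltnW lt_jn).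
have lt_p : (n - 1 - j < n)%N by lia.
pose p := Ordinal lt_p.
have def_gk : g ord0 p *+ k = (s * (2 * e + 1))%:R.
  rewrite def_k mulnC mulrnA code_gen_pivot /=; last lia.
  by rewrite -mulrnA mulnC.
have := near_zk p; rewrite def_gk => /(absZq_tile t_gt1 q_def (near_z p))/eqP.
rewrite natr_Zp_eq0 // q_def mulnC dvdn_pmul2r ?addn1 // => dvd_ts.
by rewrite def_k expnS dvdn_mul.
Qed.

End Code.

(** * The balls around the codewords *)

Lemma mem_ball_max (q n r : nat) (x y : 'rV['Z_q]_n) :
  reflect (forall i : 'I_n, absZq (x ord0 i - y ord0 i)%R <= r)%N
          (y \in ball_max x r).
Proof.
rewrite inE /dist_max; apply: (iffP (bigmax_leqP _ _ _)) => [le_r i | le_r i _];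
  exact: le_r.
Qed.

Theorem corollary4p8 (n e t q : nat) (n_ge1 : (1 <= n)%N) (t_gt1 : (1 < t)%N)
    (q_def : q = ((2 * e + 1) * t)%N)
    (t_dvd : (t ^ (n - 1) %| 2 * e + 1)%N) :
  cyclic_code n e t q \in LPL n e q.
Proof.
have q_gt1 : (1 < q)%N by nia.
rewrite inE; apply/and3P; split.
- rewrite cardG_gt1 cycle_eq1; apply/eqP => g0.
  (* The last entry of the generator is 2e+1, which lies strictly between 0
     and q. *)
  have lt_p : (n - 1 < n)%N by lia.
  have := code_gen_pivot q t_dvd (addn0 (Ordinal lt_p)).
  rewrite g0 mxE mul0rn => /esym/eqP; rewrite natr_Zp_eq0 //.
  by move/dvdn_leq; nia.
- apply/eqP/setP => x; rewrite inE; apply/bigcupP.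
  have [k near_k] := codeword_near t_dvd t_gt1 q_def x.
  exists (code_gen n e t q *+ k); first by rewrite -FinRing.zmodXgE mem_cycle.
  by apply/mem_ball_max => i; rewrite mulmxnE.
- apply/forall_inP => c Cc; apply/forall_inP => c' Cc'; apply/implyP.
  apply: contraR => /pred0Pn[y /= /andP[]].
  move=> /mem_ball_max near_c /mem_ball_max near_c'.
  have /cycleP[k def_k] : (c^-1 * c')%g \in cyclic_code n e t q.
    by rewrite groupM ?groupV.
  have def_c' : c' = c + code_gen n e t q *+ k.
    by rewrite -FinRing.zmodXgE -def_k -FinRing.zmodMgE mulKVg.
  rewrite def_c' (codeword_eq0 t_dvd t_gt1 q_def (z := c - y)) ?addr0 // => i.
    by have := near_c i; rewrite !mxE.
  by have := near_c' i; rewrite def_c' !mxE mulmxnE addrAC !mxE.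
Qed.
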